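(* Let $\mathcal{A}\in\mathbb{C}^{h\times n\times r}$, $\mathcal{B}\in\mathbb{C}^{h\times k\times r}$, $\mathcal{C}\in\mathbb{C}^{a\times b\times r}$, $\mathcal{D}\in\mathbb{C}^{l\times d\times r}$, and let $p$ be a positive integer with $n=pk$, $l=pa$ and $b=d$. Write $\mathcal{A}=[\widetilde{\mathcal{A}}_1\ \cdots\ \widetilde{\mathcal{A}}_p]$ with $\widetilde{\mathcal{A}}_g\in\mathbb{C}^{h\times k\times r}$ consisting of the lateral slices $(g-1)k+1,\dots,gk$ of $\mathcal{A}$, and let $\mathcal{D}_g\in\mathbb{C}^{a\times b\times r}$ be the sub-tensor of $\mathcal{D}$ consisting of the horizontal slices $(g-1)a+1,\dots,ga$, $g=1,\dots,p$. Then the system $\mathcal{A}\ltimes X=\mathcal{B}$, $X\ltimes\mathcal{C}=\mathcal{D}$ is solvable with $X\in\mathbb{C}^p$ if and only if the following system in the unknown scalars $x_1,\dots,x_p\in\mathbb{C}$ is solvable: $$\left\{\begin{aligned}&x_1\mathcal{V}_L(\widetilde{\mathcal{A}}_1)+x_2\mathcal{V}_L(\widetilde{\mathcal{A}}_2)+\cdots+x_p\mathcal{V}_L(\widetilde{\mathcal{A}}_p)=\mathcal{V}_L(\mathcal{B})\in\mathbb{C}^{rhk},\\&x_g\mathcal{V}_L(\mathcal{C})=\mathcal{V}_L(\mathcal{D}_g)\in\mathbb{C}^{rab},\qquad g=1,\dots,p.\end{aligned}\right.$$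
   Context: Tensors are third-order arrays over $\mathbb{C}$, with all dimensions positive integers. A vector in $\mathbb{C}^p$ is regarded as a $p\times 1\times 1$ tensor. Horizontal (resp. lateral, frontal) slices are obtained by fixing the first (resp. second, third) index. For a matrix $M$, $V_c(M)$ is the column vector obtained by stacking the columns of $M$. For $\mathcal{A}\in\mathbb{C}^{n_1\times n_2\times n_3}$, the lateral form $\mathcal{V}_L(\mathcal{A})\in\mathbb{C}^{n_1n_2n_3}$ is the column vector obtained by stacking $V_c(\mathcal{A}(:1:)),V_c(\mathcal{A}(:2:)),\dots,V_c(\mathcal{A}(:n_2:))$, where $\mathcal{A}(:j:)$ is the $j$-th lateral slice viewed as an $n_1\times n_3$ matrix. $[x,y]$ denotes the least common multiple. $I_{n\times n\times k}$ is the identity tensor: its first frontal slice is the $n\times n$ identity matrix and its other frontal slices are zero. The Kronecker product of $\mathcal{A}\in\mathbb{C}^{n_1\times n_2\times n_3}$ and $\mathcal{B}\in\mathbb{C}^{p_1\times p_2\times p_3}$ is the $n_1p_1\times n_2p_2\times n_3p_3$ tensor whose entry at position $((i_1-1)p_1+j_1,(i_2-1)p_2+j_2,(i_3-1)p_3+j_3)$ is $a_{i_1i_2i_3}b_{j_1j_2j_3}$. The t-product of $\mathcal{A}\in\mathbb{C}^{m\times n\times r}$ and $\mathcal{B}\in\mathbb{C}^{n\times s\times r}$ is $\mathcal{A}*\mathcal{B}\in\mathbb{C}^{m\times s\times r}$ whose $k$-th frontal slice is $\sum_{i+j\equiv k+1\ (\mathrm{mod}\ r)}\mathcal{A}_{(::i)}\mathcal{B}_{(::j)}$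 (sum over $1\le i,j\le r$). The semi-tensor product of $\mathcal{A}\in\mathbb{C}^{m\times n\times r}$ and $\mathcal{B}\in\mathbb{C}^{p\times q\times s}$ is $\mathcal{A}\ltimes\mathcal{B}=(\mathcal{A}\otimes I_{\frac{t}{n}\times\frac{t}{n}\times\frac{e}{r}})*(\mathcal{B}\otimes I_{\frac{t}{p}\times\frac{t}{p}\times\frac{e}{s}})\in\mathbb{C}^{\frac{mt}{n}\times\frac{qt}{p}\times e}$, where $t=[n,p]$ and $e=[r,s]$. *)

(* Defs.v *)
From HB Require Import structures.
From mathcomp Require Import all_boot all_order all_algebra.
From mathcomp Require Import mxtens complex.
From mathcomp Require Import reals.

Set Implicit Arguments.
Unset Strict Implicit.
Unset Printing Implicit Defensive.

Import Order.TTheory GRing.Theory Num.Theory.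
Local Open Scope ring_scope.

(* An n1 x n2 x n3 tensor is given by its frontal slices: A l i j is the entry
   a_{i+1, j+1, l+1}, all indices being 0-based. *)
Definition tensor (K : Type) (n1 n2 n3 : nat) := {ffun 'I_n3 -> 'M[K]_(n1, n2)}.

Definition castT (K : Type) n1 n2 n3 n1' n2' n3'
    (e : (n1 = n1') * (n2 = n2') * (n3 = n3')) (A : tensor K n1 n2 n3) :
    tensor K n1' n2' n3' :=
  [ffun l => castmx e.1 (A (cast_ord (esym e.2) l))].

(* Equality of tensors whose dimensions, such as h * (lcmn n p %/ n) and h, are
   equal without being convertible: equal dimensions and equal entries. *)
Definition eqT (K : Type) n1 n2 n3 n1' n2' n3'
    (A : tensor K n1 n2 n3) (B : tensor K n1' n2' n3') : Prop :=
  exists e : (n1 = n1') * (n2 = n2') * (n3 = n3'), castT e A = B.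

Section Tensors.

Variable K : comNzRingType.

Definition tensor_of_cV p (x : 'cV[K]_p) : tensor K p 1 1 := [ffun=> x].

Definition idT n k : tensor K n n k :=
  [ffun l : 'I_k => if val l == 0%N then 1%:M else 0].

(* mxtens_index (i, j) = i * p + j, mxtens_unindex is its inverse, and *t is the
   Kronecker product of matrices. *)
Definition kronT n1 n2 n3 p1 p2 p3
    (A : tensor K n1 n2 n3) (B : tensor K p1 p2 p3) :
    tensor K (n1 * p1) (n2 * p2) (n3 * p3) :=
  [ffun l => A (mxtens_unindex l).1 *t B (mxtens_unindex l).2].

Lemma kronTE n1 n2 n3 p1 p2 p3
    (A : tensor K n1 n2 n3) (B : tensor K p1 p2 p3) i1 i2 i3 j1 j2 j3 :
  kronT A B (mxtens_index (i3, j3)) (mxtens_index (i1, j1))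
        (mxtens_index (i2, j2)) = A i3 i1 i2 * B j3 j1 j2.
Proof. by rewrite ffunE mxE !mxtens_indexK. Qed.

(* The condition i + j = k + 1 (mod r) on 1-based indices reads
   i + j = k (mod r) on 0-based ones. *)
Definition tprod m n s r (A : tensor K m n r) (B : tensor K n s r) :
    tensor K m s r :=
  [ffun k : 'I_r =>
     \sum_(i < r) \sum_(j < r | i + j == k %[mod r]) A i *m B j].

Lemma mul_lcmn_divl n p : (n * (lcmn n p %/ n) = lcmn n p)%N.
Proof. by rewrite mulnC divnK // dvdn_lcml. Qed.

Lemma mul_lcmn_divr n p : (p * (lcmn n p %/ p) = lcmn n p)%N.
Proof. by rewrite mulnC divnK // dvdn_lcmr. Qed.

Definition stp m n r p q s (A : tensor K m n r) (B : tensor K p q s) :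
    tensor K (m * (lcmn n p %/ n)) (q * (lcmn n p %/ p)) (lcmn r s) :=
  tprod
    (castT (erefl, mul_lcmn_divl n p, mul_lcmn_divl r s)
       (kronT A (idT (lcmn n p %/ n) (lcmn r s %/ r))))
    (castT (mul_lcmn_divr n p, erefl, mul_lcmn_divr r s)
       (kronT B (idT (lcmn n p %/ p) (lcmn r s %/ s)))).

(* Column stacking: the entry at position j * m + i is M i j. *)
Definition Vc m n (M : 'M[K]_(m, n)) : 'cV[K]_(n * m) :=
  \col_k M (mxtens_unindex k).2 (mxtens_unindex k).1.

Definition lateral_slice n1 n2 n3 (A : tensor K n1 n2 n3) (j : 'I_n2) :
    'M[K]_(n1, n3) :=
  \matrix_(i, l) A l i j.

(* Stacking the vectors Vc (lateral_slice A j) amounts to stacking the columns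
   of the matrix that has these vectors as columns. *)
Definition VL n1 n2 n3 (A : tensor K n1 n2 n3) : 'cV[K]_(n2 * (n3 * n1)) :=
  Vc (\matrix_(i, j) Vc (lateral_slice A j) i 0).

Lemma VLE n1 n2 n3 (A : tensor K n1 n2 n3) i j l :
  VL A (mxtens_index (j, mxtens_index (l, i))) 0 = A l i j.
Proof.
by rewrite /VL /Vc /lateral_slice mxE !mxtens_indexK !mxE mxtens_indexK.
Qed.

(* Lateral slices g * k, ..., g * k + k - 1 (0-based). *)
Definition lateral_block h k r p (A : tensor K h (p * k) r) (g : 'I_p) :
    tensor K h k r :=
  [ffun l => \matrix_(i, j) A l i (mxtens_index (g, j))].

(* Horizontal slices g * a, ..., g * a + a - 1 (0-based). *)
Definition horizontal_block a b r p (D : tensor K (p * a) b r) (g : 'I_p) :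
    tensor K a b r :=
  [ffun l => \matrix_(i, j) D l (mxtens_index (g, i)) j].

End Tensors.

(* Main.v *)
(* Since X is p x 1 x 1 and p divides n, the identity tensor attached to A
   (resp. C) is 1 x 1 x 1, while the one attached to X turns it into a
   tensor whose only nonzero frontal slice is the first one, X *t 1%:M. The
   t-product with such a tensor is a slicewise matrix product, so the blocks of
   A are combined with coefficients X g (resp. block g of the second product is
   X g times C). The map VL, being linear and injective, turns these tensor
   equations into the vector equations. *)

Require Import Defs.
From mathcomp Require Import all_boot all_order all_algebra.
From mathcomp Require Import mxtens complex.
From mathcomp Require Import reals.

Set Implicit Arguments.
Unset Strict Implicit.
Unset Printing Implicit Defensive.

Import Order.TTheory GRing.Theory Num.Theory.
Local Open Scope ring_scope.

Section Casts.

Variable K : Type.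

Lemma castTE n1 n2 n3 n1' n2' n3' (e : (n1 = n1') * (n2 = n2') * (n3 = n3'))
    (A : tensor K n1 n2 n3) l i j :
  castT e A l i j =
  A (cast_ord (esym e.2) l) (cast_ord (esym e.1.1) i)
    (cast_ord (esym e.1.2) j).
Proof. by rewrite ffunE castmxE. Qed.

Lemma tensorP n1 n2 n3 (A B : tensor K n1 n2 n3) :
  (forall l i j, A l i j = B l i j) <-> A = B.
Proof.
split=> [AB | -> //]; apply/ffunP => l; apply/matrixP => i j; exact: AB.
Qed.

(** The proofs in [e] are arbitrary: [cast_ord] keeps the value of an index whatever proof it
    receives. *)
Lemma castT_id n1 n2 n3 (e : (n1 = n1) * (n2 = n2) * (n3 = n3))
    (A : tensor K n1 n2 n3) : castT e A = A.
Proof. by apply/tensorP => l i j; rewrite castTE !cast_ord_id. Qed.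

Lemma eqT_refl n1 n2 n3 (A : tensor K n1 n2 n3) : eqT A A.
Proof. by exists (erefl, erefl, erefl); rewrite castT_id. Qed.

(** This trades an equation between tensors of formally different dimensions for a plain equality,
    once [S] is identified with some [A] typed like [B]. *)
Lemma eqT_eq n1 n2 n3 n1' n2' n3' (S : tensor K n1 n2 n3)
    (A B : tensor K n1' n2' n3') : eqT S A -> (eqT S B <-> A = B).
Proof.
case=> [[[e1 e2] e3]]; case: _ / e1 A B; case: _ / e2; case: _ / e3 => A B.
rewrite castT_id => <-; split=> [[e] | <-]; first by rewrite castT_id.
exact: eqT_refl.
Qed.

End Casts.

Section Products.

Variable K : comNzRingType.

Lemma mxtens_unindexl1 m (i : 'I_(m * 1)) :
  mxtens_unindex i = (cast_ord (muln1 m) i, ord0).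
Proof.
apply: (can_inj (@mxtens_indexK _ _)); rewrite mxtens_unindexK.
by apply: val_inj => /=; rewrite [RHS]addn0 [RHS]muln1.
Qed.

Lemma mxtens_unindex1l m (i : 'I_(1 * m)) :
  mxtens_unindex i = (ord0, cast_ord (mul1n m) i).
Proof.
apply: (can_inj (@mxtens_indexK _ _)); rewrite mxtens_unindexK.
exact: val_inj.
Qed.

Lemma kronT_id1 n1 n2 n3 (A : tensor K n1 n2 n3) : eqT (kronT A (idT K 1 1)) A.
Proof.
exists (muln1 n1, muln1 n2, muln1 n3); apply/tensorP => l i j.
rewrite castTE !ffunE mxE !mxtens_unindexl1 /= mxE eqxx mulr1.
by congr (A _ _ _); apply: val_inj.
Qed.

(* The matrix x *t 1%:M, with its number of columns 1 * k rewritten as k. *)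
Definition tens_id p k (x : 'cV[K]_p) : 'M[K]_(p * k, k) :=
  \matrix_(i, j)
    (x (mxtens_unindex i).1 0 * ((mxtens_unindex i).2 == j)%:R).

(** As [x] has one column and one frontal slice, the column and frontal indices of the product come
    from [idT] alone. *)
Lemma kronT_cV_id p k r (x : 'cV[K]_p) :
  eqT (kronT (tensor_of_cV x) (idT K k r))
      [ffun l : 'I_r => if val l == 0%N then tens_id k x else 0].
Proof.
exists (erefl, mul1n k, mul1n r); apply/tensorP => l i j.
rewrite castTE cast_ord_id !ffunE mxE !mxtens_unindex1l /=.
by case: eqP => _; rewrite !mxE ?mulr0 // cast_ordKV.
Qed.

(** Only [j = 0] contributes, and the congruence then forces [i = l], both indices being below
    [r]. *)
Lemma tprod_slice0r m n s r (r_gt0 : (0 < r)%N)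
    (A : tensor K m n r) (M : 'M[K]_(n, s)) :
  tprod A [ffun l : 'I_r => if val l == 0%N then M else 0] =
  [ffun l => A l *m M].
Proof.
apply/ffunP => l; rewrite !ffunE (bigD1 l) //=.
rewrite [X in _ + X]big1 => [|i il].
  rewrite addr0 (bigD1 (Ordinal r_gt0)) /=; last by rewrite addn0.
  rewrite ffunE eqxx big1 ?addr0 // => j /andP[_ jn0].
  by rewrite ffunE -[val j == _]/(j == Ordinal r_gt0) (negPf jn0) mulmx0.
rewrite big1 // => j ijl; rewrite ffunE; case: eqP => [j0|]; last first.
  by rewrite mulmx0.
move: ijl il; rewrite j0 addn0 !modn_small // => /eqP/val_inj->.
by rewrite eqxx.
Qed.

Lemma tprod_slice0l m n s r (r_gt0 : (0 < r)%N)
    (M : 'M[K]_(m, n)) (B : tensor K n s r) :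
  tprod [ffun l : 'I_r => if val l == 0%N then M else 0] B =
  [ffun l => M *m B l].
Proof.
apply/ffunP => l; rewrite !ffunE (bigD1 (Ordinal r_gt0)) //=.
rewrite [X in _ + X]big1 => [|i i0].
  rewrite addr0 (bigD1 l) /=; last by rewrite add0n.
  rewrite ffunE eqxx big1 ?addr0 // => j /andP[].
  by rewrite add0n !modn_small // => /eqP/val_inj->; rewrite eqxx.
rewrite big1 // => j _; rewrite ffunE.
by rewrite -[val i == _]/(i == Ordinal r_gt0) (negPf i0) mul0mx.
Qed.

(** This allows each factor of [stp] to be simplified separately, although its dimensions change
    type. *)
Lemma tprod_eqT m n s r m' n' s' r' (A : tensor K m n r) (B : tensor K n s r)
    (A' : tensor K m' n' r') (B' : tensor K n' s' r') :
  eqT A A' -> eqT B B' -> eqT (tprod A B) (tprod A' B').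
Proof.
case=> [[[e1 e2] e3]]; case: _ / e1 A'; case: _ / e2 B'; case: _ / e3 => B' A'.
(* The equalities on [n] and [r] now have identical sides, so only the one on [s] is left to
   eliminate. *)
rewrite castT_id => <- [[[e1 e2] e3]]; case: _ / e2 B' => B'.
rewrite castT_id => <-; exact: eqT_refl.
Qed.

Lemma castT_eqT n1 n2 n3 n1' n2' n3' m1 m2 m3
    (e : (n1 = n1') * (n2 = n2') * (n3 = n3')) (A : tensor K n1 n2 n3)
    (B : tensor K m1 m2 m3) : eqT A B -> eqT (castT e A) B.
Proof.
case: e => [[e1 e2] e3]; case: _ / e1; case: _ / e2; case: _ / e3.
by rewrite castT_id.
Qed.

Lemma sum_mxtens_index (V : nmodType) m n (F : 'I_(m * n) -> V) :
  \sum_q F q = \sum_(i < m) \sum_(j < n) F (mxtens_index (i, j)).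
Proof.
rewrite pair_big (reindex (@mxtens_index m n)) /=; last first.
  exists (@mxtens_unindex m n) => u _; first exact: mxtens_indexK.
  exact: mxtens_unindexK.
by apply: eq_bigr => -[].
Qed.

Lemma stp_cVr h k r p (A : tensor K h (p * k) r) (x : 'cV[K]_p) :
  (0 < r)%N -> (0 < k)%N -> (0 < p)%N ->
  eqT (stp A (tensor_of_cV x))
      [ffun l => \sum_g x g 0 *: lateral_block A g l].
Proof.
move=> r0 k0 p0.
have lE : lcmn (p * k) p = (p * k)%N by apply/lcmn_idPl; rewrite dvdn_mulr.
suff <- : tprod A [ffun l : 'I_r => if val l == 0%N then tens_id k x else 0]
    = [ffun l => \sum_g x g 0 *: lateral_block A g l].
  apply: tprod_eqT; apply: castT_eqT.
    (* Positivity matters here: [m %/ m] is 1 only for [m > 0], and 0 otherwise. *)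
    rewrite lE lcmn1 !divnn muln_gt0 p0 k0 r0; exact: kronT_id1.
  rewrite lE lcmn1 divn1 mulKn //; exact: kronT_cV_id.
rewrite tprod_slice0r //; apply/tensorP => l i j.
(* The summation index splits into a block [g] and a position [j'] in it; the Kronecker delta of
   [tens_id] keeps only [j' = j]. *)
rewrite !ffunE mxE summxE sum_mxtens_index; apply: eq_bigr => g _.
rewrite (bigD1 j) //= big1 => [|j' j'j].
  by rewrite !mxE mxtens_indexK /= eqxx ffunE mxE mulr1 addr0 mulrC.
by rewrite !mxE mxtens_indexK /= (negPf j'j) !mulr0.
Qed.

Lemma stp_cVl a b r p (C : tensor K a b r) (x : 'cV[K]_p) :
  (0 < r)%N -> (0 < a)%N -> (0 < p)%N ->
  eqT (stp (tensor_of_cV x) C)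
      [ffun l => \matrix_(i < p * a, j < b)
         (x (mxtens_unindex i).1 0 * C l (mxtens_unindex i).2 j)].
Proof.
move=> r0 a0 p0.
suff <- : tprod [ffun l : 'I_r => if val l == 0%N then tens_id a x else 0] C
    = [ffun l => \matrix_(i < p * a, j < b)
         (x (mxtens_unindex i).1 0 * C l (mxtens_unindex i).2 j)].
  apply: tprod_eqT; apply: castT_eqT.
    rewrite !lcm1n !divn1; exact: kronT_cV_id.
  rewrite !lcm1n !divnn a0 r0; exact: kronT_id1.
rewrite tprod_slice0l //; apply/tensorP => l i j.
(* Row [i] of [tens_id a x] has one possibly nonzero entry, in the column given by the position of
   [i] inside its block. *)
rewrite !ffunE !mxE (bigD1 (mxtens_unindex i).2) //= big1 => [|q qi].
  by rewrite !mxE eqxx mulr1 addr0.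
by rewrite !mxE eq_sym (negPf qi) mulr0 mul0r.
Qed.

(** By [VLE], each entry of a tensor can be read off its stacked vector. *)
Lemma VL_inj n1 n2 n3 : injective (@VL K n1 n2 n3).
Proof. by move=> A B AB; apply/tensorP => l i j; rewrite -!VLE AB. Qed.

Lemma VL_sumZ n1 n2 n3 p (x : 'I_p -> K) (F : 'I_p -> tensor K n1 n2 n3) :
  \sum_g x g *: VL (F g) = VL [ffun l => \sum_g x g *: F g l].
Proof.
apply/matrixP => i j; rewrite summxE !mxE ffunE summxE.
by apply: eq_bigr => g _; rewrite !mxE.
Qed.

Lemma VLZ n1 n2 n3 (x : K) (A : tensor K n1 n2 n3) :
  x *: VL A = VL [ffun l => x *: A l].
Proof. by apply/matrixP => i j; rewrite !mxE ffunE !mxE. Qed.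

End Products.

Theorem theorem3p3 (R : realType) (h n r k a b l d p : nat)
  (h_gt0 : (0 < h)%N) (n_gt0 : (0 < n)%N) (r_gt0 : (0 < r)%N)
  (k_gt0 : (0 < k)%N) (a_gt0 : (0 < a)%N) (b_gt0 : (0 < b)%N)
  (l_gt0 : (0 < l)%N) (d_gt0 : (0 < d)%N) (p_gt0 : (0 < p)%N)
  (A : tensor R[i] h n r) (B : tensor R[i] h k r)
  (C : tensor R[i] a b r) (D : tensor R[i] l d r)
  (n_pk : n = (p * k)%N) (l_pa : l = (p * a)%N) (b_d : b = d) :
  (exists X : 'cV[R[i]]_p,
     eqT (stp A (tensor_of_cV X)) B /\ eqT (stp (tensor_of_cV X) C) D)
  <->
  (exists x : 'I_p -> R[i],
     \sum_(g < p)
        x g *: VL (lateral_block (castT (erefl, n_pk, erefl) A) g) = VL B /\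
     forall g : 'I_p,
       x g *: VL C =
       VL (horizontal_block (castT (l_pa, esym b_d, erefl) D) g)).
Proof.
(* Once the dimensions are substituted, the casts in the statement are identities. *)
subst n l d; rewrite !castT_id.
have lateralE (X : 'cV_p) : eqT (stp A (tensor_of_cV X)) B <->
    \sum_g X g 0 *: VL (lateral_block A g) = VL B.
  rewrite (eqT_eq _ (stp_cVr A X r_gt0 k_gt0 p_gt0)) VL_sumZ.
  by split=> [-> // | /VL_inj].
have horizontalE (X : 'cV_p) : eqT (stp (tensor_of_cV X) C) D <->
    forall g, X g 0 *: VL C = VL (horizontal_block D g).
  rewrite (eqT_eq _ (stp_cVl C X r_gt0 a_gt0 p_gt0)).
  split=> [<- g | CD].
    rewrite VLZ; congr VL; apply/tensorP => m i j.
    by rewrite !ffunE !mxE mxtens_indexK.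
  (* Every row of [D] lies in exactly one horizontal block, so the equations for all [g] together
     determine all of [D]. *)
  apply/tensorP => m i j; rewrite ffunE mxE -[i in RHS]mxtens_unindexK.
  case: (mxtens_unindex i) => g i' /=.
  move: (CD g); rewrite VLZ => /VL_inj/tensorP/(_ m i' j).
  by rewrite !ffunE !mxE.
split=> [[X [/lateralE AB /horizontalE CD]] | [x [AB CD]]].
  by exists (fun g => X g 0).
exists (\col_g x g); split; [apply/lateralE | apply/horizontalE => g].
  by rewrite -AB; apply: eq_bigr => g _; rewrite mxE.
by rewrite mxE.
Qed.
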